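(* Let $\{|f_1\rangle,|f_2\rangle\}$ be the orthonormal basis of $\mathbb{C}^2$ given by $|f_1\rangle=(|0\rangle+|1\rangle)/\sqrt2$, $|f_2\rangle=(|0\rangle-|1\rangle)/\sqrt2$, and let $f_1=|f_1\rangle\langle f_1|$. A linear map $\Lambda: M_2(\mathbb{C})\to M_2(\mathbb{C})$ is completely positive, trace preserving and satisfies $\Lambda(f_1)=f_1$ if and only if there exist $\eta\in\mathbb{R}$ and $\lambda,q\in\mathbb{C}$ with $$0\le\eta\le 1,\qquad |\lambda|^2\le\eta,\qquad |q|^2\le(1-\eta)\left(\eta-|\lambda|^2\right),$$ such that the unnormalized Choi matrix $J_\Lambda=\sum_{j,k=1}^{2}|f_j\rangle\langle f_k|\otimes\Lambda(|f_j\rangle\langle f_k|)$, written in the ordered basis $\{|f_1\rangle\otimes|f_1\rangle,\ |f_1\rangle\otimes|f_2\rangle,\ |f_2\rangle\otimes|f_1\rangle,\ |f_2\rangle\otimes|f_2\rangle\}$, is $$J_\Lambda=\begin{pmatrix}1&0&0&\lambda\\0&0&0&0\\0&0&1-\eta&q\\\lambda^*&0&q^*&\eta\end{pmatrix}.$$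
   Context: $\{|0\rangle,|1\rangle\}$ is the standard basis of $\mathbb{C}^2$. Maps that are completely positive and trace preserving with $\Lambda(f_1)=f_1$ are called the free operations (of quantum-state texture) for a single qubit. The asterisk denotes complex conjugation. *)

(* Defs.v *)
From mathcomp Require Import all_boot all_order all_algebra.
From mathcomp Require Import sesquilinear spectral.
From mathcomp Require Import mxtens complex.
From mathcomp Require Import reals.

Set Implicit Arguments.
Unset Strict Implicit.
Unset Printing Implicit Defensive.

Import Order.TTheory GRing.Theory Num.Theory.
Local Open Scope ring_scope.
Local Open Scope sesquilinear_scope.

(* The field of complex numbers is R[i] for R : realType. Kets are column
   vectors, and M ^t* is the conjugate transpose. *)

Definition psdmx (R : realType) (n : nat) (A : 'M[R[i]]_n) : Prop :=
  A \is hermsymmx /\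
  forall v : 'cV[R[i]]_n, 0 <= (v ^t* *m A *m v) 0 0.

(* (i, j) block, of size m, of X seen as an element of M_k (x) M_m *)
Definition tens_block (R : realType) (k m : nat) (X : 'M[R[i]]_(k * m))
    (i j : 'I_k) : 'M[R[i]]_m :=
  \matrix_(a, b) X (mxtens_index (i, a)) (mxtens_index (j, b)).

(* id_{M_k} (x) L *)
Definition ampliation (R : realType) (m n k : nat)
    (L : 'M[R[i]]_m -> 'M[R[i]]_n) (X : 'M[R[i]]_(k * m)) :
    'M[R[i]]_(k * n) :=
  \sum_(i < k) \sum_(j < k) delta_mx i j *t L (tens_block X i j).

Definition completely_positive (R : realType) (m n : nat)
    (L : 'M[R[i]]_m -> 'M[R[i]]_n) : Prop :=
  forall (k : nat) (X : 'M[R[i]]_(k * m)), psdmx X -> psdmx (ampliation L X).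

Definition trace_preserving (R : realType) (m n : nat)
    (L : 'M[R[i]]_m -> 'M[R[i]]_n) : Prop :=
  forall X : 'M[R[i]]_m, \tr (L X) = \tr X.

Definition ket (R : realType) (i : 'I_2) : 'cV[R[i]]_2 := delta_mx i 0.

Definition ketbra (R : realType) (m n : nat) (u : 'cV[R[i]]_m)
    (v : 'cV[R[i]]_n) : 'M[R[i]]_(m, n) := u *m v ^t*.

(* The indices 1, 2 of f_1, f_2 are shifted to 0, 1. *)
Definition fket (R : realType) (j : 'I_2) : 'cV[R[i]]_2 :=
  (Num.sqrt (2 : R))%:C%C^-1 *:
    (if j == 0 then ket R 0 + ket R 1 else ket R 0 - ket R 1).

Definition f1 (R : realType) : 'M[R[i]]_2 := ketbra (fket R 0) (fket R 0).

Definition free_operation (R : realType) (L : 'M[R[i]]_2 -> 'M[R[i]]_2) :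
    Prop :=
  [/\ completely_positive L, trace_preserving L & L (f1 R) = f1 R].

Definition choi (R : realType) (L : 'M[R[i]]_2 -> 'M[R[i]]_2) :
    'M[R[i]]_(2 * 2) :=
  \sum_(j < 2) \sum_(k < 2)
    ketbra (fket R j) (fket R k) *t L (ketbra (fket R j) (fket R k)).

(* mxtens_unindex enumerates the pairs lexicographically, so this is the ordered
   basis f_1 (x) f_1, f_1 (x) f_2, f_2 (x) f_1, f_2 (x) f_2. *)
Definition ffket (R : realType) (a : 'I_(2 * 2)) : 'cV[R[i]]_(2 * 2) :=
  fket R (mxtens_unindex a).1 *t fket R (mxtens_unindex a).2.

(* Matrix of A in the orthonormal basis ffket: entries <e_a|A|e_b>. *)
Definition mx_in_ff (R : realType) (A : 'M[R[i]]_(2 * 2)) :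
    'M[R[i]]_(2 * 2) :=
  \matrix_(a, b) ((ffket R a) ^t* *m A *m ffket R b) 0 0.

Definition mx_of_rows (T : pzRingType) (m n : nat) (s : seq (seq T)) :
    'M[T]_(m, n) :=
  \matrix_(i, j) nth 0 (nth [::] s i) j.

(* Main.v *)
(** For a free operation, [L f_1 = f_1] forces the (f_1 f_2, f_1 f_2) diagonal
    entry of the positive semidefinite Choi matrix to vanish, hence that whole
    row and column; trace preservation then fixes every entry but [lambda], [q]
    and [eta]. The bounds on these are positivity of the diagonal and of a
    2 x 2 minor of the Schur complement of the top left entry 1. Conversely,
    under the bounds a Cholesky factorisation writes the matrix as
    [v_1 v_1^* + v_2 v_2^* + v_3 v_3^*], and reshaping each [v_r] into a
    2 x 2 matrix gives a Kraus decomposition of [L]. *)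

Require Import Defs.
From mathcomp Require Import all_boot all_order all_algebra.
From mathcomp Require Import sesquilinear spectral.
From mathcomp Require Import mxtens complex.
From mathcomp Require Import reals.
From mathcomp Require Import ring.

Set Implicit Arguments.
Unset Strict Implicit.
Unset Printing Implicit Defensive.

Import Order.TTheory GRing.Theory Num.Theory.
Local Open Scope ring_scope.
Local Open Scope sesquilinear_scope.

(** * Adjoints and positive semidefinite matrices *)

Lemma adjmxE (C : numClosedFieldType) m n (A : 'M[C]_(m, n)) i j :
  (A ^t*) i j = (A j i)^*.
Proof. by rewrite !mxE. Qed.

Lemma adjmxM (C : numClosedFieldType) m n p (A : 'M[C]_(m, n))
    (B : 'M[C]_(n, p)) : (A *m B) ^t* = B ^t* *m A ^t*.
Proof. by rewrite trmx_mul map_mxM. Qed.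

Lemma adjmx_tens (C : numClosedFieldType) m n p q (A : 'M[C]_(m, n))
    (B : 'M[C]_(p, q)) : (A *t B) ^t* = A ^t* *t B ^t*.
Proof. by rewrite trmx_tens map_mxT. Qed.

Lemma adjmx_sum (C : numClosedFieldType) m n (I : finType)
    (F : I -> 'M[C]_(m, n)) : (\sum_i F i) ^t* = \sum_i (F i) ^t*.
Proof. by rewrite (linear_sum (trmx : _ -> 'M[C]_(n, m))) map_mx_sum. Qed.

Lemma adjmx1 (C : numClosedFieldType) n : (1%:M : 'M[C]_n) ^t* = 1%:M.
Proof. by rewrite trmx1 map_mx1. Qed.

Lemma psdmxP (R : realType) n (A : 'M[R[i]]_n) : psdmx A <->
  A ^t* = A /\ forall v : 'cV[R[i]]_n, 0 <= (v ^t* *m A *m v) 0 0.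
Proof.
rewrite /psdmx is_hermitianmxE expr0 scale1r.
by split=> -[hA psdA]; split=> //; [apply/esym/eqP | rewrite hA].
Qed.

Lemma psdmx_congr (R : realType) m n (B : 'M[R[i]]_(m, n)) (A : 'M[R[i]]_n) :
  psdmx A -> psdmx (B *m A *m B ^t*).
Proof.
move=> /psdmxP[hA psdA]; apply/psdmxP; split.
  by rewrite !adjmxM trmxCK hA mulmxA.
by move=> v; have := psdA (B ^t* *m v); rewrite adjmxM trmxCK !mulmxA.
Qed.

Lemma psdmx_sum (R : realType) n (I : finType) (F : I -> 'M[R[i]]_n) :
  (forall i, psdmx (F i)) -> psdmx (\sum_i F i).
Proof.
move=> psdF; apply/psdmxP; split.
  by rewrite adjmx_sum; apply: eq_bigr => i _; have /psdmxP[] := psdF i.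
move=> v; rewrite mulmx_sumr mulmx_suml summxE; apply: sumr_ge0 => i _.
by have /psdmxP[_] := psdF i; apply.
Qed.

Lemma psdmx_ketbra (R : realType) n (u : 'cV[R[i]]_n) : psdmx (ketbra u u).
Proof.
have psd1 : psdmx (1%:M : 'M[R[i]]_1).
  apply/psdmxP; split=> [|v]; first exact: adjmx1.
  by rewrite mulmx1 !mxE big_ord1 !mxE mulrC mul_conjC_ge0.
by have := psdmx_congr u psd1; rewrite mulmx1.
Qed.

(** * Principal minors and Schur complements *)

Lemma hermitian_form2_ge0 (C : numClosedFieldType) (a b c : C) :
  (forall x y : C, 0 <= x^* * x * a + x^* * y * c + y^* * x * c^*
     + y^* * y * b) ->
  `|c| ^+ 2 <= a * b.
Proof.
move=> Q.
have a_ge0 : 0 <= a.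
  by have := Q 1 0; rewrite conjC1 conjC0 !(mul0r, mulr0, mul1r, addr0).
have b_ge0 : 0 <= b.
  by have := Q 0 1; rewrite conjC1 conjC0 !(mul0r, mulr0, mul1r, addr0, add0r).
have aC : a^* = a by apply/CrealP/ger0_real.
have bC : b^* = b by apply/CrealP/ger0_real.
rewrite -subr_ge0 normCK.
have [a0|a_neq0] := eqVneq a 0; last first.
  have a_gt0 : 0 < a by rewrite lt_def a_neq0.
  have := Q (- c) a.
  by rewrite rmorphN /= aC -(pmulr_rge0 _ a_gt0); congr (0 <= _); ring.
have [b0|b_neq0] := eqVneq b 0; last first.
  have b_gt0 : 0 < b by rewrite lt_def b_neq0.
  have := Q b (- c^*).
  by rewrite rmorphN /= conjCK bC -(pmulr_rge0 _ b_gt0); congr (0 <= _); ring.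
have := Q (- c) 1; rewrite a0 b0 rmorphN /= conjC1.
by rewrite -(pmulr_rge0 (_ - _) (ltr0Sn C 1)); congr (0 <= _); ring.
Qed.

Lemma form_delta2 (C : numClosedFieldType) n (A : 'M[C]_n) i j (x y : C)
    (v := x *: delta_mx i 0 + y *: delta_mx j 0 : 'cV[C]_n) :
  (v ^t* *m A *m v) 0 0 = x^* * x * A i i + x^* * y * A i j
    + y^* * x * A j i + y^* * y * A j j.
Proof.
have -> : v ^t* = x^* *: delta_mx 0 i + y^* *: delta_mx 0 j.
  apply/matrixP=> a b; rewrite !mxE rmorphD !rmorphM !rmorph_nat.
  by rewrite ![_ && (a == 0)]andbC.
rewrite /v mulmxDl !mulmxDr -!scalemxAl -!scalemxAr -!rowE -!colE !mxE.
by ring.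
Qed.

(** Testing positivity on vectors supported on the coordinates [i] and [j] leaves a Hermitian form
    in two variables. *)
Lemma psdmx_minor2 (R : realType) n (A : 'M[R[i]]_n) i j :
  psdmx A -> `|A i j| ^+ 2 <= A i i * A j j.
Proof.
move=> /psdmxP[hA psdA].
apply: hermitian_form2_ge0 => x y.
have -> : (A i j)^* = A j i by rewrite -[in RHS]hA !mxE.
by rewrite -form_delta2; apply: psdA.
Qed.

(** One step of Gaussian elimination with pivot 1: [B] clears column [i] of [A], after which the
    right factor [B ^t*] changes nothing. The Schur complement keeps its full size, with row and
    column [i] zero. *)
Lemma schur_congr (C : numClosedFieldType) n (A : 'M[C]_n) i
    (B := 1%:M - col i A *m delta_mx 0 i) :
  A ^t* = A -> A i i = 1 ->
  B *m A *m B ^t* = \matrix_(j, k) (A j k - A j i * A i k).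
Proof.
move=> hA Aii.
have hcol : (col i A) ^t* = row i A.
  by apply/matrixP=> a b; rewrite -[in RHS]hA !mxE.
have hd : (delta_mx 0 i : 'rV[C]_n) ^t* = delta_mx i 0.
  by apply/matrixP=> a b; rewrite !mxE rmorph_nat andbC.
have -> : B ^t* = 1%:M - delta_mx i 0 *m row i A.
  by rewrite /B !raddfB /= adjmx1 adjmxM hcol hd.
have -> : B *m A = A - col i A *m row i A.
  by rewrite mulmxBl mul1mx -mulmxA -rowE.
rewrite mulmxBr mulmx1 mulmxA mulmxBl -colE -mulmxA -colE.
have -> : col i A *m col i (row i A) = col i A.
  by apply/matrixP=> a b; rewrite !mxE big_ord1 !mxE Aii mulr1.
rewrite subrr mul0mx subr0; apply/matrixP=> a b.
by rewrite !mxE big_ord1 !mxE.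
Qed.

Lemma psdmx_schur (R : realType) n (A : 'M[R[i]]_n) i :
  psdmx A -> A i i = 1 -> psdmx (\matrix_(j, k) (A j k - A j i * A i k)).
Proof.
move=> psdA Aii; have /psdmxP[hA _] := psdA.
by rewrite -(schur_congr hA Aii); exact: psdmx_congr.
Qed.

(** * Block decompositions, ampliations and Kraus maps *)

Lemma tens_blockE (R : realType) k m (X : 'M[R[i]]_(k * m)) :
  X = \sum_(i < k) \sum_(j < k) delta_mx i j *t tens_block X i j.
Proof.
apply/matrixP=> x y; case: (mxtens_indexP x) => i a; case: (mxtens_indexP y) => j b.
rewrite summxE (bigD1 i) //= [X in _ + X]big1 ?addr0 => [|i' ne_i'i]; last first.
  rewrite summxE big1 // => j' _.
  by rewrite tensmxE mxE eq_sym (negPf ne_i'i) mul0r.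
rewrite summxE (bigD1 j) //= [X in _ + X]big1 ?addr0 => [|j' ne_j'j]; last first.
  by rewrite tensmxE mxE [j == _]eq_sym (negPf ne_j'j) andbF mul0r.
by rewrite tensmxE !mxE !eqxx mul1r.
Qed.

Lemma tens_block_tens (R : realType) k m (A : 'M[R[i]]_k) (B : 'M[R[i]]_m) i j :
  tens_block (A *t B) i j = A i j *: B.
Proof. by apply/matrixP=> a b; rewrite !mxE !mxtens_indexK. Qed.

Lemma tens_block_sum (R : realType) k m (I : finType)
    (F : I -> 'M[R[i]]_(k * m)) i j :
  tens_block (\sum_r F r) i j = \sum_r tens_block (F r) i j.
Proof.
apply/matrixP=> a b; rewrite mxE !summxE.
by apply: eq_bigr => r _; rewrite mxE.
Qed.

Lemma ampliation_tens (R : realType) m n k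
    (L : {linear 'M[R[i]]_m -> 'M[R[i]]_n}) (A : 'M[R[i]]_k) (B : 'M[R[i]]_m) :
  ampliation L (A *t B) = A *t L B.
Proof.
rewrite [RHS]tens_blockE /ampliation; apply: eq_bigr => i _.
by apply: eq_bigr => j _; rewrite !tens_block_tens linearZ.
Qed.

Lemma tensmx_sumr (C : comNzRingType) m n p q (I : finType) (A : 'M[C]_(m, n))
    (F : I -> 'M[C]_(p, q)) : A *t (\sum_r F r) = \sum_r A *t F r.
Proof.
apply/matrixP=> x y; case: (mxtens_indexP x) => i a; case: (mxtens_indexP y) => j b.
rewrite tensmxE !summxE mulr_sumr.
by apply: eq_bigr => r _; rewrite tensmxE.
Qed.

Lemma ampliation_sum (R : realType) m n k (I : finType)
    (L : {linear 'M[R[i]]_m -> 'M[R[i]]_n}) (F : I -> 'M[R[i]]_(k * m)) :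
  ampliation L (\sum_r F r) = \sum_r ampliation L (F r).
Proof.
rewrite /ampliation [RHS]exchange_big /=; apply: eq_bigr => i _.
rewrite [RHS]exchange_big /=; apply: eq_bigr => j _.
by rewrite tens_block_sum linear_sum tensmx_sumr.
Qed.

(** The ampliation is again of Kraus form, with operators [1%:M *t K r], hence a sum of
    congruences. *)
Lemma completely_positive_kraus (R : realType) m n (I : finType)
    (L : 'M[R[i]]_m -> 'M[R[i]]_n) (K : I -> 'M[R[i]]_(n, m)) :
  (forall X, L X = \sum_r K r *m X *m (K r) ^t*) -> completely_positive L.
Proof.
move=> LE k X psdX.
suff -> : ampliation L X = \sum_r (1%:M *t K r) *m X *m (1%:M *t K r) ^t*.
  by apply: psdmx_sum => r; apply: psdmx_congr.
transitivity (\sum_r \sum_i \sum_j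
    delta_mx i j *t (K r *m tens_block X i j *m (K r) ^t*)).
  rewrite [RHS]exchange_big /=; apply: eq_bigr => i _.
  rewrite [RHS]exchange_big /=; apply: eq_bigr => j _.
  by rewrite LE tensmx_sumr.
apply: eq_bigr => r _; rewrite adjmx_tens adjmx1 [in RHS](tens_blockE X).
rewrite mulmx_sumr mulmx_suml; apply: eq_bigr => i _.
rewrite mulmx_sumr mulmx_suml; apply: eq_bigr => j _.
by rewrite !tensmx_mul mul1mx mulmx1.
Qed.

(** * The orthonormal basis [fket] *)

Lemma ketbraE (R : realType) m n (u : 'cV[R[i]]_m) (v : 'cV[R[i]]_n) i j :
  ketbra u v i j = u i 0 * (v j 0)^*.
Proof. by rewrite mxE big_ord1 adjmxE. Qed.

(** These are the entries of the Hadamard matrix; a single real formula covers both kets. *)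
Lemma fketE (R : realType) (i j : 'I_2) (o : 'I_1) :
  fket R j i o = ((-1) ^+ (i * j) / Num.sqrt (2 : R))%:C%C.
Proof.
rewrite /fket ord1 rmorphM rmorphXn rmorphN1 fmorphV mulrC.
by case: j i => [[|[|//]] hj] [[|[|//]] hi];
   rewrite !mxE /= ?mul1n ?expr1 ?mulr0 ?addr0 ?add0r ?subr0 ?sub0r.
Qed.

Lemma conj_fket (R : realType) (i j : 'I_2) (o : 'I_1) :
  (fket R j i o)^* = fket R j i o.
Proof. by apply/CrealP; rewrite fketE complex_real. Qed.

Lemma fket_orthonormal (R : realType) (j k : 'I_2) :
  (fket R j) ^t* *m fket R k = ((j == k)%:R)%:M.
Proof.
have half : (Num.sqrt (2 : R))^-1 * (Num.sqrt 2)^-1 = 2^-1.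
  by rewrite -invfM -expr2 sqr_sqrtr.
apply/matrixP=> a b; rewrite !ord1 [LHS]mxE big_ord_recl big_ord1.
rewrite !adjmxE !conj_fket !fketE -!rmorphM -rmorphD /= [RHS]mxE eqxx mulr1n.
rewrite -(rmorph_nat (real_complex R)); congr (_%:C)%C.
rewrite mulrACA half [X in _ + X]mulrACA half -!exprD !mul0n !mul1n expr0.
by case: j k => [[|[|//]] hj] [[|[|//]] hk] /=; field.
Qed.

Lemma fket_complete (R : realType) :
  \sum_j ketbra (fket R j) (fket R j) = 1%:M.
Proof.
(* Orthonormality says [H ^t* *m H = 1%:M]; as [H] is square, also [H *m H ^t* = 1%:M], which is
   completeness. *)
pose H : 'M[R[i]]_2 := \matrix_(i, j) fket R j i 0.
have HH : H ^t* *m H = 1%:M.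
  apply/matrixP=> j k; rewrite [RHS]mxE; have := fket_orthonormal R j k.
  move=> /matrixP/(_ 0 0); rewrite mxE [RHS]mxE mulr1n => <-.
  by rewrite mxE; apply: eq_bigr => i _; rewrite !adjmxE ![H _ _]mxE.
rewrite -(mulmx1C HH); apply/matrixP=> a b; rewrite summxE mxE.
by apply: eq_bigr => j _; rewrite ketbraE adjmxE ![H _ _]mxE.
Qed.

(** * Matrix elements in the basis [fket] *)

Definition braket (R : realType) n (u : 'cV[R[i]]_n) (A : 'M[R[i]]_n)
  (v : 'cV[R[i]]_n) : R[i] := (u ^t* *m A *m v) 0 0.

Lemma braket_sum (R : realType) n (I : finType) (u v : 'cV[R[i]]_n)
    (F : I -> 'M[R[i]]_n) :
  braket u (\sum_r F r) v = \sum_r braket u (F r) v.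
Proof. by rewrite /braket mulmx_sumr mulmx_suml summxE. Qed.

Lemma braketZ (R : realType) n (u v : 'cV[R[i]]_n) c (A : 'M[R[i]]_n) :
  braket u (c *: A) v = c * braket u A v.
Proof. by rewrite /braket -scalemxAr -scalemxAl mxE. Qed.

Lemma braket_congr (R : realType) m n (u v : 'cV[R[i]]_n) (K : 'M[R[i]]_(n, m))
    (x y : 'cV[R[i]]_m) :
  braket u (K *m ketbra x y *m K ^t*) v =
    (u ^t* *m K *m x) 0 0 * ((v ^t* *m K *m y) 0 0)^*.
Proof.
rewrite /braket /ketbra -[in RHS]adjmxE !adjmxM trmxCK !mulmxA.
by rewrite -2![in LHS]mulmxA [LHS]mxE big_ord1 !mulmxA.
Qed.

Lemma braket_fket_ketbra (R : realType) (a b j k : 'I_2) :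
  braket (fket R a) (ketbra (fket R j) (fket R k)) (fket R b)
    = ((a == j) && (k == b))%:R.
Proof.
rewrite /braket /ketbra mulmxA fket_orthonormal -mulmxA fket_orthonormal.
by rewrite -scalar_mxM mxE eqxx mulr1n -natrM mulnb.
Qed.

Lemma braket_tens (R : realType) m n (u v : 'cV[R[i]]_m) (w z : 'cV[R[i]]_n)
    (A : 'M[R[i]]_m) (B : 'M[R[i]]_n) :
  braket (u *t w : 'cV_(m * n)) (A *t B) (v *t z : 'cV_(m * n))
    = braket u A v * braket w B z.
Proof.
rewrite /braket.
(* The type ascriptions identify the dimension [1 * 1] of a tensor of kets or bras with [1], so that
   [tensmx_mul] applies. *)
have -> : (u *t w : 'cV_(m * n)) ^t* *m (A *t B) =
    (u ^t* *m A) *t (w ^t* *m B) :> 'M_(1, m * n).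
  by rewrite (adjmx_tens u w); exact: (tensmx_mul (u ^t*) (w ^t*) A B).
have -> : (((u ^t* *m A) *t (w ^t* *m B)) : 'M_(1, m * n)) *m
    (v *t z : 'cV_(m * n)) = (u ^t* *m A *m v) *t (w ^t* *m B *m z) :> 'M_1.
  exact: (tensmx_mul (u ^t* *m A) (w ^t* *m B) v z).
by rewrite [LHS]mxE !ord1.
Qed.

(** The resolution of the identity [fket_complete] is inserted on both sides of [A]. *)
Lemma fbasis_expand (R : realType) (A : 'M[R[i]]_2) :
  A = \sum_j \sum_k
    braket (fket R j) A (fket R k) *: ketbra (fket R j) (fket R k).
Proof.
rewrite -{1}[A]mul1mx -{1}[A]mulmx1 -fket_complete mulmx_suml.
apply: eq_bigr => j _; rewrite !mulmx_sumr; apply: eq_bigr => k _.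
have -> : ketbra (fket R j) (fket R j) *m (A *m ketbra (fket R k) (fket R k)) =
    fket R j *m ((fket R j) ^t* *m A *m fket R k) *m (fket R k) ^t*.
  by rewrite /ketbra !mulmxA.
by rewrite [X in _ *m X *m _]mx11_scalar mul_mx_scalar -scalemxAl.
Qed.

Lemma eq_braket_fket (R : realType) (A B : 'M[R[i]]_2) :
  (forall a b, braket (fket R a) A (fket R b) = braket (fket R a) B (fket R b))
  -> A = B.
Proof.
move=> eqAB; rewrite [A]fbasis_expand [B]fbasis_expand.
by apply: eq_bigr => a _; apply: eq_bigr => b _; rewrite eqAB.
Qed.

Lemma mxtrace_braket_fket (R : realType) (A : 'M[R[i]]_2) :
  \tr A = \sum_a braket (fket R a) A (fket R a).
Proof.
rewrite -{1}[A]mulmx1 -fket_complete mulmx_sumr linear_sum /=.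
apply: eq_bigr => a _.
by rewrite /ketbra mulmxA mxtrace_mulC mulmxA /braket trace_mx11.
Qed.

(** * The Choi matrix and its Kraus operators *)

Lemma mx_in_ffE (R : realType) (A : 'M[R[i]]_(2 * 2)) x y :
  mx_in_ff A x y = braket (ffket R x) A (ffket R y).
Proof. by rewrite mxE. Qed.

(** Orthonormality leaves a single term of the double sum. This is the dictionary between [L] and
    its Choi matrix: [j], [k] index the input and [a], [b] the output. *)
Lemma mx_in_ff_choi (R : realType) (L : 'M[R[i]]_2 -> 'M[R[i]]_2) j a k b :
  mx_in_ff (choi L) (mxtens_index (j, a)) (mxtens_index (k, b)) =
    braket (fket R a) (L (ketbra (fket R j) (fket R k))) (fket R b).
Proof.
rewrite mx_in_ffE /choi /ffket !mxtens_indexK braket_sum.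
under eq_bigr => j' _ do rewrite braket_sum.
rewrite (bigD1 j) //= [X in _ + X]big1 ?addr0 => [|j' ne_j'j]; last first.
  rewrite big1 // => k' _.
  by rewrite braket_tens braket_fket_ketbra eq_sym (negPf ne_j'j) mul0r.
rewrite (bigD1 k) //= [X in _ + X]big1 ?addr0 => [|k' ne_k'k]; last first.
  by rewrite braket_tens braket_fket_ketbra (negPf ne_k'k) andbF mul0r.
by rewrite braket_tens braket_fket_ketbra !eqxx mul1r.
Qed.

Lemma psdmx_mx_in_ff (R : realType) (A : 'M[R[i]]_(2 * 2)) :
  psdmx A -> psdmx (mx_in_ff A).
Proof.
(* The columns of [V] are the product basis kets, so the change of basis is a congruence by
   [V ^t*]. *)
pose V : 'M[R[i]]_(2 * 2) := \matrix_(x, y) ffket R y x 0.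
have colV y : col y V = ffket R y.
  by apply/matrixP=> x o; rewrite ord1 mxE [LHS]mxE.
suff -> : mx_in_ff A = V ^t* *m A *m (V ^t*) ^t* by apply: psdmx_congr.
apply/matrixP=> x y; rewrite mx_in_ffE -!colV trmxCK /braket.
rewrite tr_col map_row -row_mul [LHS]mxE [RHS]mxE; apply: eq_bigr => z _.
by congr (_ * _); rewrite [LHS]mxE.
Qed.

(** The Choi matrix is the ampliation of [L] at [ketbra u u], where [u] is the unnormalized
    maximally entangled vector. *)
Lemma psdmx_choi (R : realType) (L : {linear 'M[R[i]]_2 -> 'M[R[i]]_2}) :
  completely_positive L -> psdmx (choi L).
Proof.
pose u : 'cV[R[i]]_(2 * 2) := \sum_j (fket R j *t fket R j : 'cV_(2 * 2)).
have uuE : ketbra u u = \sum_j \sum_k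
    ketbra (fket R j) (fket R k) *t ketbra (fket R j) (fket R k).
  rewrite /ketbra {1}/u mulmx_suml; apply: eq_bigr => j _.
  rewrite adjmx_sum mulmx_sumr; apply: eq_bigr => k _.
  by rewrite (adjmx_tens (fket R k) (fket R k))
             (tensmx_mul (fket R j) (fket R j) ((fket R k) ^t*)).
move=> /(_ 2 _ (psdmx_ketbra u)); rewrite uuE ampliation_sum.
congr psdmx; apply: eq_bigr => j _; rewrite ampliation_sum.
by apply: eq_bigr => k _; rewrite ampliation_tens.
Qed.

(** Inverse of vectorization in the basis [fket]: the first tensor factor becomes the input, the
    second the output. *)
Definition kraus_of_vec (R : realType) (v : 'cV[R[i]]_(2 * 2)) : 'M[R[i]]_2 :=
  \sum_j \sum_a v (mxtens_index (j, a)) 0 *: ketbra (fket R a) (fket R j).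

Lemma braket_kraus_of_vec (R : realType) (v : 'cV[R[i]]_(2 * 2)) a j :
  braket (fket R a) (kraus_of_vec v) (fket R j) = v (mxtens_index (j, a)) 0.
Proof.
rewrite braket_sum; under eq_bigr => k _ do rewrite braket_sum.
rewrite (bigD1 j) //= [X in _ + X]big1 ?addr0 => [|j' ne_j'j]; last first.
  rewrite big1 // => k' _.
  by rewrite braketZ braket_fket_ketbra (negPf ne_j'j) andbF mulr0.
rewrite (bigD1 a) //= [X in _ + X]big1 ?addr0 => [|a' ne_a'a]; last first.
  by rewrite braketZ braket_fket_ketbra eq_sym (negPf ne_a'a) mulr0.
by rewrite braketZ braket_fket_ketbra !eqxx mulr1.
Qed.

(** By linearity it suffices to compare on the operators [ketbra (fket R j) (fket R k)], where the
    [r]-th Kraus term has as matrix elements the entries of [ketbra (v r) (v r)]. *)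
Lemma kraus_of_choi (R : realType) (L : {linear 'M[R[i]]_2 -> 'M[R[i]]_2})
    (I : finType) (v : I -> 'cV[R[i]]_(2 * 2)) :
  mx_in_ff (choi L) = \sum_r ketbra (v r) (v r) ->
  forall X, L X = \sum_r kraus_of_vec (v r) *m X *m (kraus_of_vec (v r)) ^t*.
Proof.
move=> choiE X.
have basis j k : L (ketbra (fket R j) (fket R k)) =
    \sum_r kraus_of_vec (v r) *m ketbra (fket R j) (fket R k)
             *m (kraus_of_vec (v r)) ^t*.
  apply: eq_braket_fket => a b; rewrite -mx_in_ff_choi choiE summxE braket_sum.
  apply: eq_bigr => r _; rewrite ketbraE braket_congr.
  by rewrite -!/(braket _ _ _) !braket_kraus_of_vec.
rewrite (fbasis_expand X) linear_sum /=.
under [RHS]eq_bigr => r _ do rewrite mulmx_sumr mulmx_suml.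
rewrite [RHS]exchange_big /=; apply: eq_bigr => j _.
rewrite linear_sum /=.
under [RHS]eq_bigr => r _ do rewrite mulmx_sumr mulmx_suml.
rewrite [RHS]exchange_big /=; apply: eq_bigr => k _.
rewrite linearZ /= basis scaler_sumr; apply: eq_bigr => r _.
by rewrite -scalemxAr -scalemxAl.
Qed.

(** * Factoring and characterising the explicit matrix *)

Lemma cholesky2 (C : numClosedFieldType) (a b q : C) :
  0 <= a -> 0 <= b -> `|q| ^+ 2 <= a * b ->
  exists s p t : C, [/\ s * s^* = a, s * p^* = q & p * p^* + t * t^* = b].
Proof.
move=> a_ge0 b_ge0 qab; pose s := sqrtC a.
have sC : s^* = s by apply/CrealP/ger0_real; rewrite sqrtC_ge0.
have ss : s * s = a by rewrite -expr2 sqrtCK.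
(* A zero pivot forces [q = 0], and [t] alone accounts for [b]. *)
have [a0|a_neq0] := eqVneq a 0.
  have q0 : q = 0.
    apply/eqP; rewrite -normr_eq0 -sqrf_eq0 eq_le.
    by rewrite exprn_ge0 // andbT (le_trans qab) // a0 mul0r.
  have tC : (sqrtC b)^* = sqrtC b by apply/CrealP/ger0_real; rewrite sqrtC_ge0.
  exists 0, 0, (sqrtC b); rewrite a0 q0 !mul0r add0r tC -expr2 sqrtCK.
  by split.
have a_gt0 : 0 < a by rewrite lt_def a_neq0.
have s_neq0 : s != 0 by rewrite sqrtC_eq0.
(* The square of [t] is the Schur complement of the pivot [a], nonnegative by [qab]. *)
pose t := sqrtC (b - `|q| ^+ 2 / a).
have tC : t^* = t.
  apply/CrealP/ger0_real; rewrite sqrtC_ge0 subr_ge0.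
  by rewrite ler_pdivrMr // mulrC.
exists s, (q^* / s), t; rewrite sC tC rmorphM fmorphV /= conjCK sC; split=> //.
  by rewrite mulrCA divff // mulr1.
rewrite mulrACA -invfM ss -expr2 sqrtCK normCK (mulrC q).
by rewrite addrC subrK.
Qed.

(** The second hypothesis encodes [L (f1 R) = f1 R] and the third trace preservation on the basis
    operators, both read through [mx_in_ff_choi]. *)
Lemma texture_choi_of_psd (R : realType) (J : 'M[R[i]]_(2 * 2))
    (J_ := fun j a k b => J (mxtens_index (j, a)) (mxtens_index (k, b))) :
  psdmx J ->
  (forall a b, J_ 0 a 0 b = ((a == 0) && (b == 0))%:R) ->
  (forall j k, \sum_a J_ j a k a = (j == k)%:R) ->
  exists (eta : R) (lambda q : R[i]),
    [/\ 0 <= eta <= 1,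
        `|lambda| ^+ 2 <= eta%:C%C,
        `|q| ^+ 2 <= (1 - eta%:C%C) * (eta%:C%C - `|lambda| ^+ 2) &
        J =
        mx_of_rows (2 * 2) (2 * 2)
          [:: [:: 1;        0; 0;              lambda   ];
              [:: 0;        0; 0;              0        ];
              [:: 0;        0; 1 - eta%:C%C;   q        ];
              [:: lambda^*; 0; q^*;            eta%:C%C ]]].
Proof.
move=> psdJ fix00 tr; have /psdmxP[hJ _] := psdJ.
have herm j a k b : J_ j a k b = (J_ k b j a)^* by rewrite /J_ -adjmxE hJ.
have diag_ge0 n (A : 'M[R[i]]_n) x : psdmx A -> 0 <= A x x.
  move=> /psdmxP[_ /(_ (delta_mx x 0))]; rewrite -colE mxE.
  rewrite (_ : (delta_mx x 0) ^t* = delta_mx 0 x) -?rowE ?mxE //.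
  by apply/matrixP=> y z; rewrite !mxE rmorph_nat andbC.
(* The diagonal entry [J_ 0 1 0 1] is zero, so the minor bound kills its whole column. *)
have col01 j a : J_ j a 0 1 = 0.
  apply/eqP; rewrite -normr_eq0 -sqrf_eq0 eq_le exprn_ge0 // andbT.
  apply: le_trans (psdmx_minor2 _ _ psdJ) _.
  by rewrite -[X in _ * X]/(J_ 0 1 0 1) fix00 mulr0.
have row01 j a : J_ 0 1 j a = 0 by rewrite herm col01 conjC0.
have sum2 (F : 'I_2 -> R[i]) : \sum_a F a = F 0 + F 1.
  by rewrite big_ord_recl big_ord1; congr (_ + F _); apply: val_inj.
(* The off-diagonal block has trace zero, and its other diagonal entry lies in the vanishing row. *)
have J0010 : J_ 0 0 1 0 = 0 by have := tr 0 1; rewrite sum2 row01 addr0.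
have J1000 : J_ 1 0 0 0 = 0 by rewrite herm J0010 conjC0.
have J0000 : J_ 0 0 0 0 = 1 by rewrite fix00.
have etaE : (complex.Re (J_ 1 1 1 1))%:C%C = J_ 1 1 1 1.
  by apply/RRe_real/ger0_real/diag_ge0.
have J1010 : J_ 1 0 1 0 = 1 - J_ 1 1 1 1.
  by apply/esym/eqP; rewrite subr_eq -(sum2 (fun a => J_ 1 a 1 a)) tr eqxx.
have lamE : `|J_ 0 0 1 1| ^+ 2 = J_ 1 1 0 0 * J_ 0 0 1 1.
  by rewrite normCK mulrC -herm.
(* On the last two indices the Schur complement has diagonal [1 - eta], [eta - |lambda|^2] and
   off-diagonal entry [q]: its last diagonal entry and its minor give the two remaining bounds. *)
have psdS := psdmx_schur psdJ J0000.
exists (complex.Re (J_ 1 1 1 1)), (J_ 0 0 1 1), (J_ 1 0 1 1); rewrite etaE; split.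
- rewrite -!lecR etaE diag_ge0 //= -subr_ge0 -J1010.
  exact: diag_ge0.
- have := diag_ge0 _ _ (mxtens_index (1, 1)) psdS; rewrite mxE.
  by rewrite -!/(J_ _ _ _ _) subr_ge0 lamE.
- have := psdmx_minor2 (mxtens_index (1, 0)) (mxtens_index (1, 1)) psdS.
  rewrite !mxE -!/(J_ _ _ _ _) J1000 J0010 !mul0r !subr0 J1010.
  by rewrite lamE.
have J_E j a k b : J (mxtens_index (j, a)) (mxtens_index (k, b)) = J_ j a k b.
  by [].
apply/matrixP=> x y; case: (mxtens_indexP x) => j a.
case: (mxtens_indexP y) => k b; rewrite J_E [RHS]mxE.
have ord2 (z : 'I_2) : z = 0 \/ z = 1.
  by case: z => [[|[|//]] hz]; [left | right]; apply: val_inj.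
case: (ord2 j) => ->; case: (ord2 a) => ->; case: (ord2 k) => ->;
  case: (ord2 b) => -> /=;
  rewrite ?(col01, row01, J0000, J0010, J1000, J1010) //;
  exact: herm.
Qed.

Lemma texture_choi_rank1 (R : realType) (eta : R) (lambda q : R[i]) :
  0 <= eta <= 1 -> `|lambda| ^+ 2 <= eta%:C%C ->
  `|q| ^+ 2 <= (1 - eta%:C%C) * (eta%:C%C - `|lambda| ^+ 2) ->
  exists v : 'I_3 -> 'cV[R[i]]_(2 * 2),
    mx_of_rows (2 * 2) (2 * 2)
      [:: [:: 1;        0; 0;              lambda   ];
          [:: 0;        0; 0;              0        ];
          [:: 0;        0; 1 - eta%:C%C;   q        ];
          [:: lambda^*; 0; q^*;            eta%:C%C ]]
    = \sum_r ketbra (v r) (v r).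
Proof.
move=> /andP[_ eta_le1] lam_le qle.
have [||s [p [t [ssE spE ptE]]]] := cholesky2 _ _ qle.
- by rewrite subr_ge0 lecR.
- by rewrite subr_ge0.
have psE : p * s^* = q^* by rewrite -spE rmorphM /= conjCK mulrC.
(* The first vector produces the first row and column and leaves the Schur complement; the other two
   are the Cholesky columns of that complement. *)
exists (fun r => \col_x nth 0 (nth [::]
  [:: [:: 1; 0; 0; lambda^*]; [:: 0; 0; s; p]; [:: 0; 0; 0; t]] r) x).
apply/matrixP=> x y; rewrite [LHS]mxE summxE.
under eq_bigr do rewrite ketbraE !mxE.
rewrite !big_ord_recl big_ord0 /= addr0.
case: x => [[|[|[|[|//]]]] hx]; case: y => [[|[|[|[|//]]]] hy] /=;
  rewrite ?(conjC0, conjC1, conjCK, mul0r, mulr0, mul1r, mulr1, addr0, add0r)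
          ?ssE ?spE ?psE //.
by rewrite ptE mulrC -normCK addrC subrK.
Qed.

(** * The characterisation of free operations *)

Theorem mainTheorem1 (R : realType)
    (L : {linear 'M[R[i]]_2 -> 'M[R[i]]_2}) :
  free_operation L <->
  exists (eta : R) (lambda q : R[i]),
    [/\ 0 <= eta <= 1,
        `|lambda| ^+ 2 <= eta%:C%C,
        `|q| ^+ 2 <= (1 - eta%:C%C) * (eta%:C%C - `|lambda| ^+ 2) &
        mx_in_ff (choi L) =
        mx_of_rows (2 * 2) (2 * 2)
          [:: [:: 1;        0; 0;              lambda   ];
              [:: 0;        0; 0;              0        ];
              [:: 0;        0; 1 - eta%:C%C;   q        ];
              [:: lambda^*; 0; q^*;            eta%:C%C ]]].
Proof.
split=> [[cpL trL fixL]|[eta [lambda [q [eta01 lam_le q_le choiE]]]]].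
  apply: texture_choi_of_psd.
  - exact/psdmx_mx_in_ff/psdmx_choi.
  - by move=> a b; rewrite mx_in_ff_choi fixL braket_fket_ketbra [0 == b]eq_sym.
  - move=> j k; under eq_bigr do rewrite mx_in_ff_choi.
    rewrite -mxtrace_braket_fket trL mxtrace_braket_fket.
    under eq_bigr do rewrite braket_fket_ketbra.
    rewrite (bigD1 j) //= eqxx big1 ?addr0 ?[k == j]eq_sym // => a ne_aj.
    by rewrite (negPf ne_aj).
have entry j a k b := mx_in_ff_choi L j a k b.
rewrite choiE in entry.
split.
- have [v vE] := texture_choi_rank1 eta01 lam_le q_le.
  by apply: completely_positive_kraus (kraus_of_choi _); rewrite choiE vE.
(* Each trace of an image is the trace of a 2 x 2 block of the explicit matrix: 1 for the diagonal
   blocks, 0 for the others. *)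
- have basis j k : \tr (L (ketbra (fket R j) (fket R k)))
      = \tr (ketbra (fket R j) (fket R k)).
    rewrite !mxtrace_braket_fket; apply/esym.
    under eq_bigr do rewrite braket_fket_ketbra.
    under [RHS]eq_bigr do rewrite -entry mxE.
    rewrite !big_ord_recl !big_ord0 !addr0.
    case: j k => [[|[|//]] hj] [[|[|//]] hk] /=;
      by rewrite ?(addr0, add0r, subrK).
  move=> X; rewrite (fbasis_expand X) !linear_sum /=; apply: eq_bigr => j _.
  rewrite !linear_sum /=; apply: eq_bigr => k _.
  by rewrite !linearZ /= basis.
(* The image of [f1 R] is read off the top left block, whose only nonzero entry is the corner 1. *)
- apply: eq_braket_fket => a b; rewrite -entry braket_fket_ketbra mxE.
  by case: a b => [[|[|//]] ha] [[|[|//]] hb].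
Qed.
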